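(* Let $G$ be a hypergraph with vertex set $\{1,\dots,n\}$ and let $T\subset\{1,\dots,n\}$ be a cut set with $m$ elements, $1\le m<n$. If there is a hyperedge $\epsilon\in E(G)$ such that $\epsilon\cap V_T\ne\emptyset$ and $\epsilon\cap V_{\overline T}\ne\emptyset$, then the hypergraph state $|G\rangle$ is entangled with respect to the cut set $T$.
   Context: $[2^n]=\{0,1,\dots,2^n-1\}$, and $\mathrm{bin}(i)=(i_1,\dots,i_n)\in\{0,1\}^n$ is the $n$-term binary representation of $i$ (most significant digit first). $|0\rangle,|1\rangle$ is the standard basis of $\mathcal H_2=\mathbb C^2$, and $|\mathrm{bin}(i)\rangle=|i_1\rangle\otimes\cdots\otimes|i_n\rangle$. A hypergraph $G=(V(G),E(G))$ has vertex set $V(G)=\{1,\dots,n\}$ and a set $E(G)$ of hyperedges, each a subset of $V(G)$. For $e\subseteq V(G)$, $Z_e$ is the linear operator on $\mathcal H_2^{\otimes n}$ with $Z_e|\mathrm{bin}(i)\rangle=-|\mathrm{bin}(i)\rangle$ if $i_v=1$ for all $v\in e$, and $Z_e|\mathrm{bin}(i)\rangle=|\mathrm{bin}(i)\rangle$ otherwise. With $|+\rangle=\frac1{\sqrt2}(|0\rangle+|1\rangle)$, the hypergraph state is $|G\rangle=\left(\prod_{e\in E(G)}Z_e\right)|+\rangle^{\otimes n}$. A cut set $T$ is a set of $m<n$ qubit indices. It partitions the vertices into $V_T$ (the vertices with index in $T$) and $V_{\overline T}$ (the vertices with index not in $T$), and gives a factorization $\mathcal H_2^{\otimes n}=\mathcal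 H_2^{(T)}\otimes\mathcal H_2^{(\overline T)}$, where $\mathcal H_2^{(T)}$ is the tensor product of the qubit spaces with index in $T$ and $\mathcal H_2^{(\overline T)}$ that of the remaining ones. A state $|\psi\rangle$ is separable with respect to $T$ if $|\psi\rangle=|\psi_1\rangle\otimes|\psi_2\rangle$ for some $|\psi_1\rangle\in\mathcal H_2^{(T)}$ and $|\psi_2\rangle\in\mathcal H_2^{(\overline T)}$ (under this factorization); otherwise it is entangled with respect to $T$. *)

(* Defs.v *)
From HB Require Import structures.
From mathcomp Require Import all_boot all_order all_algebra.
From mathcomp Require Import reals.
From mathcomp Require Export complex.

Set Implicit Arguments.
Unset Strict Implicit.
Unset Printing Implicit Defensive.

Import Order.TTheory GRing.Theory Num.Theory.

Local Open Scope ring_scope.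

(* The n vertices {1, ..., n} are the elements of 'I_n, and E(G) is G itself. *)
Definition hypergraph (n : nat) := {set {set 'I_n}}.

Definition bits (I : finType) := {ffun I -> bool}.

Notation qubit C := {ffun bool -> C^o}.

(* Tensor product of the qubit spaces indexed by I, in coordinates with respect
   to the basis of the |x>, for x a bit string on I. *)
Notation qspace C I := {ffun bits I -> C^o}.

Section States.
Variable C : numClosedFieldType.

Definition ket (b : bool) : qubit C := [ffun c => (c == b)%:R].

Definition ket_plus : qubit C := (sqrtC 2)^-1 *: (ket false + ket true).

Definition prodstate (I : finType) (v : I -> qubit C) : qspace C I :=
  [ffun x : bits I => \prod_i v i (x i)].

Definition ketbits (I : finType) (x : bits I) : qspace C I :=
  prodstate (fun i => ket (x i)).

Section Register.
Variable n : nat.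

Definition Zfun (e : {set 'I_n}) (psi : qspace C 'I_n) : qspace C 'I_n :=
  \sum_(x : bits 'I_n)
    psi x *: (if [forall v in e, x v] then - ketbits x else ketbits x).

Fact Zfun_is_linear e : linear (Zfun e).
Proof.
move=> a p q; rewrite /Zfun scaler_sumr -big_split; apply: eq_bigr => x _ /=.
by rewrite !ffunE scalerDl scalerA.
Qed.

HB.instance Definition _ e :=
  GRing.isLinear.Build C (qspace C 'I_n) (qspace C 'I_n) *:%R (Zfun e)
    (Zfun_is_linear e).

Definition Zop (e : {set 'I_n}) : 'End(qspace C 'I_n) := linfun (Zfun e).

(* The factors commute, so the order of composition is immaterial. *)
Definition hypergraph_state (G : hypergraph n) : qspace C 'I_n :=
  (\big[@comp_lfun C _ _ _ / \1%VF]_(e in G) Zop e)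
    (prodstate (fun _ => ket_plus)).

Definition restrict (S : {set 'I_n}) (x : bits 'I_n) : bits {v | v \in S} :=
  [ffun v => x (val v)].

Definition tensor (T : {set 'I_n}) (psi1 : qspace C {v | v \in T})
    (psi2 : qspace C {v | v \in ~: T}) : qspace C 'I_n :=
  [ffun x => psi1 (restrict T x) * psi2 (restrict (~: T) x)].

Definition separable (T : {set 'I_n}) (psi : qspace C 'I_n) : Prop :=
  exists (psi1 : qspace C {v | v \in T}) (psi2 : qspace C {v | v \in ~: T}),
    psi = tensor psi1 psi2.

Definition entangled (T : {set 'I_n}) (psi : qspace C 'I_n) : Prop :=
  ~ separable T psi.

Lemma ketbitsE (I : finType) (x y : bits I) : ketbits x y = (y == x)%:R.
Proof.
rewrite ffunE; case: eqP => [->|nyx].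
  by rewrite big1 // => i _; rewrite ffunE eqxx.
have [i ni] : exists i, y i != x i.
  apply/existsP; rewrite -negb_forall; apply/negP => /forallP h; apply: nyx.
  by apply/ffunP => i; apply/eqP.
by rewrite (bigD1 i) //= ffunE (negPf ni) mul0r.
Qed.

Lemma Zop_ketbits (e : {set 'I_n}) (x : bits 'I_n) :
  Zop e (ketbits x) =
    if [forall v in e, x v] then - ketbits x else ketbits x.
Proof.
rewrite lfunE /= /Zfun (bigD1 x) //= ketbitsE eqxx scale1r.
by rewrite big1 ?addr0 // => y nyx; rewrite ketbitsE (negPf nyx) scale0r.
Qed.

Lemma tensor_prodstate (T : {set 'I_n}) (v : 'I_n -> qubit C) :
  tensor (prodstate (fun i : {i | i \in T} => v (val i)))
         (prodstate (fun i : {i | i \in ~: T} => v (val i))) = prodstate v.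
Proof.
apply/ffunP => x; rewrite !ffunE.
have sub (S : {set 'I_n}) :
    \prod_(i : {i | i \in S}) v (val i) (restrict S x i) =
      \prod_(i in S) v i (x i).
  rewrite [RHS]big_sub /=.
  by apply: eq_bigr => i _; rewrite ffunE.
rewrite !sub [RHS](bigID (mem T)) /=; congr (_ * _).
by apply: eq_bigl => i; rewrite inE.
Qed.

End Register.
End States.

(* Main.v *)
Require Import Defs.
From mathcomp Require Import all_boot all_order all_algebra.
From mathcomp Require Import reals complex.

Import GRing.Theory Num.Theory.

Local Open Scope ring_scope.

(** The amplitude of |G> at the bit string with support S is, up to a nonzero
    constant, the sign s(S) = (-1)^(number of hyperedges contained in S).
    If |G> were separable, s(e) s(set0) = s(A) s(B) would hold for every e, where
    A and B are the parts of e inside and outside T.  Choose e to be an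
    inclusion-minimal hyperedge crossing the cut: every other hyperedge inside e
    lies in A or in B and contributes equally to both sides, whereas e itself
    contributes -1 to the left-hand side only. *)

Section Amplitudes.
Variables (C : numClosedFieldType) (n : nat).
Implicit Types (e S T : {set 'I_n}) (G : hypergraph n).

Definition edge_sign e S : C := (-1) ^+ (e \subset S).

Definition graph_sign G S : C := \prod_(e in G) edge_sign e S.

Definition crossing_edge G T : pred {set 'I_n} :=
  fun f => [&& f \in G, f :&: T != set0 & f :&: ~: T != set0].

Definition indicator S : bits 'I_n := [ffun v => v \in S].

(** Each [Zop C e] is diagonal in the basis of the [ketbits x], so only the term [x = indicator S]
    survives. *)
Lemma Zop_indicator e (psi : qspace C 'I_n) S :
  Zop C e psi (indicator S) = edge_sign e S * psi (indicator S).
Proof.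
have all_indicator : [forall v in e, indicator S v] = (e \subset S).
  by apply/forall_inP/subsetP => h v /h; rewrite ffunE.
have signE (b : bool) (phi : qspace C 'I_n) x :
    (if b then - phi else phi) x = (-1) ^+ b * phi x.
  by case: b; rewrite ?ffunE ?mulN1r ?mul1r.
rewrite lfunE /= /Zfun sum_ffunE (bigD1 (indicator S)) //= big1 => [|x neq_x].
  by rewrite ffunE signE ketbitsE eqxx mulr1 all_indicator addr0 [LHS]mulrC.
by rewrite ffunE signE ketbitsE eq_sym (negPf neq_x) mulr0 scaler0.
Qed.

Lemma hypergraph_state_indicator G S :
  hypergraph_state C G (indicator S) = graph_sign G S * (sqrtC 2)^-1 ^+ n.
Proof.
have plusE b : ket_plus C b = (sqrtC 2)^-1.
  by rewrite !ffunE; case: b; rewrite /= ?addr0 ?add0r [LHS]mulr1.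
have -> : (sqrtC 2)^-1 ^+ n
    = prodstate (fun _ : 'I_n => ket_plus C) (indicator S).
  by rewrite ffunE (eq_bigr _ (fun i _ => plusE _)) prodr_const card_ord.
rewrite /hypergraph_state /graph_sign; move: (prodstate _) => psi.
elim/big_rec2: _ => [|e f s _ IH]; first by rewrite id_lfunE mul1r.
by rewrite comp_lfunE Zop_indicator IH mulrA.
Qed.

Lemma graph_sign_neq0 G S : graph_sign G S != 0.
Proof. by apply/prodf_neq0 => e _; rewrite signr_eq0. Qed.

(** Each tensor factor sees only its own side of the cut, so exchanging the parts of [S] and [S']
    outside [T] merely permutes the four scalar factors. *)
Lemma tensor_indicator T psi1 psi2 S S' :
  tensor (C := C) (T := T) psi1 psi2 (indicator S)
    * tensor psi1 psi2 (indicator S')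
  = tensor psi1 psi2 (indicator ((S :&: T) :|: (S' :&: ~: T)))
    * tensor psi1 psi2 (indicator ((S' :&: T) :|: (S :&: ~: T))).
Proof.
have restrictT U V :
    Defs.restrict T (indicator ((U :&: T) :|: (V :&: ~: T)))
    = Defs.restrict T (indicator U).
  by apply/ffunP => -[v vT]; rewrite !ffunE !inE /= vT andbT andbF orbF.
have restrictC U V :
    Defs.restrict (~: T) (indicator ((U :&: T) :|: (V :&: ~: T)))
    = Defs.restrict (~: T) (indicator V).
  apply/ffunP => -[v vT]; rewrite !ffunE !inE /=.
  by move: vT; rewrite inE => /[dup] /negPf -> ->; rewrite andbT andbF.
by rewrite ![tensor _ _ _]ffunE !restrictT !restrictC mulrACA
           [X in _ * X]mulrC mulrACA.
Qed.

Lemma graph_sign_minimal_crossing G T e :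
    minset (crossing_edge G T) e ->
  graph_sign G e * graph_sign G set0
  = - (graph_sign G (e :&: T) * graph_sign G (e :&: ~: T)).
Proof.
case/minsetP=> /and3P[eG eT eC] min_e.
rewrite /graph_sign -!big_split /= (bigD1 e) //= [in RHS](bigD1 e) //= -mulNr.
congr (_ * _).
  (* The hyperedge [e] is contained in itself but in none of [set0], [e :&: T] and [e :&: ~: T]:
     this is the one unbalanced sign. *)
  rewrite /edge_sign !subsetI subxx subset0 /=.
  have -> : (e == set0) = false.
    by apply: contraNF eT => /eqP ->; rewrite set0I.
  have -> : (e \subset T) = false.
    by apply: contraNF eC => eT'; rewrite -setDE setD_eq0.
  have -> : (e \subset ~: T) = false.
    by apply: contraNF eT => eC'; rewrite setI_eq0 disjoints_subset.
  by rewrite !mulr1.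
apply: eq_bigr => f /andP[fG neq_fe].
rewrite /edge_sign !subsetI; case: (boolP (f \subset e)) => /= [fe|nfe]; last first.
  have -> // : (f \subset set0) = false.
  by apply: contraNF nfe => /subset_trans; apply; apply: sub0set.
(* By minimality of [e], a hyperedge [f] properly inside [e] does not cross the cut. *)
have : (f \subset T) || (f \subset ~: T).
  apply: contra_neqT neq_fe; rewrite negb_or => /andP[nfT nfC].
  apply: min_e fe; rewrite /crossing_edge fG -setDE setD_eq0 nfT andbT /=.
  by rewrite setI_eq0 disjoints_subset.
(* This covers the empty hyperedge, which lies on both sides and contributes two signs to each
   product. *)
have -> : (f \subset set0) = (f \subset T) && (f \subset ~: T).
  by rewrite -subsetI setICr.
by case: (f \subset T) (f \subset ~: T) => [] [] //= _; rewrite mulrC.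
Qed.

End Amplitudes.

Theorem theorem3 (R : realType) (n m : nat) (G : hypergraph n) (T : {set 'I_n})
    (card_T : #|T| = m) (m_ge1 : (1 <= m)%N) (m_ltn : (m < n)%N)
    (crossing : exists e : {set 'I_n},
      [/\ e \in G, e :&: T <> set0 & e :&: ~: T <> set0]) :
  entangled T (hypergraph_state R[i] G).
Proof.
case=> psi1 [psi2 sep]; case: crossing => e0 [e0G /eqP e0T /eqP e0C].
have cross0 : crossing_edge n G T e0 by rewrite /crossing_edge e0G e0T.
have [e min_e _] := minset_exists cross0.
(* Exchanging with [set0] splits [e] into its parts inside and outside [T]. *)
have := tensor_indicator _ _ _ psi1 psi2 e set0.
rewrite -sep !hypergraph_state_indicator !set0I set0U setU0.
set k := _ ^+ n; rewrite !(mulrACA _ k).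
have k_neq0 : k != 0 by rewrite expf_neq0 // invr_eq0 sqrtC_eq0 pnatr_eq0.
move/(mulIf (mulf_neq0 k_neq0 k_neq0)).
rewrite (graph_sign_minimal_crossing _ _ _ _ _ min_e) => /eqP.
(* A product of signs would equal its own opposite, hence vanish. *)
by rewrite eqNr mulf_eq0 !(negPf (graph_sign_neq0 _ _ _ _)).
Qed.
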